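(* Let $\alpha>0$, $\beta\neq 0$, $0<R_w<\Delta$, and let $p_1,p_w,q$ be real numbers such that $$p_1-p_w=\frac{\alpha}{2\pi}q\ln\frac{\Delta}{R_w}+\beta\frac{q^2}{4\pi^2}\left(\frac{1}{R_w}-\frac{1}{\Delta}\right).$$ Let $\delta$ be a real number satisfying $$\delta+\beta\frac{q}{\alpha\pi^2}\left(\frac{e^{\delta\pi/2}}{\Delta}-\frac{1}{\Delta}\right)=1,$$ and set $R_0=\Delta\cdot e^{-\delta\pi/2}$. Then the system $$p_1-p_0=\frac{\alpha}{4}q,$$ $$p_1-p_w=\frac{\alpha}{2\pi}q\ln\frac{\Delta}{R_w}+\beta\frac{q^2}{4\pi^2}\left(\frac{1}{R_w}-\frac{1}{\Delta}\right),$$ $$p_0-p_w=\frac{\alpha}{2\pi}q\ln\frac{R_0}{R_w}+\beta\frac{q^2}{4\pi^2}\left(\frac{1}{R_w}-\frac{1}{R_0}\right)$$ has a solution, i.e. there exists a real number $p_0$ for which all three equations hold simultaneously.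
   Context: Interpretation of the symbols (all real numbers): $\Delta$ is the grid block size, $R_w$ the well radius, $R_0$ the well-block radius, $q$ the total flow rate, $p_w$ the well pressure, $p_0$ and $p_1$ the pressures in the well block and in its neighbouring blocks, $\alpha$ the Darcy coefficient and $\beta$ the Forchheimer coefficient. *)

(* Defs.v *)
(* Stdlib real numbers; no auxiliary definition is needed. *)
From Stdlib Require Export Reals.

(* Main.v *)
(* Subtracting the third equation from the second leaves
   [alpha q / 4 = alpha q / (2 PI) ln (Delta / R0) + beta q^2 / (4 PI^2) (1/R0 - 1/Delta)];
   since [ln (Delta / R0) = delta PI / 2], this is [alpha q / 4] times the
   equation defining [delta], so [p0 = p1 - alpha q / 4] works. *)
Require Import Defs.
From Stdlib Require Import Reals Lra.
Local Open Scope R_scope.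

Theorem theorem5 (alpha beta Delta Rw p1 pw q delta : R)
  (alpha_gt0 : 0 < alpha) (beta_neq0 : beta <> 0)
  (Rw_gt0 : 0 < Rw) (Rw_lt_Delta : Rw < Delta)
  (pressure_drop :
     p1 - pw = alpha / (2 * PI) * q * ln (Delta / Rw)
               + beta * (q ^ 2 / (4 * PI ^ 2)) * (1 / Rw - 1 / Delta))
  (delta_eq :
     delta + beta * (q / (alpha * PI ^ 2))
             * (exp (delta * PI / 2) / Delta - 1 / Delta) = 1) :
  let R0 := Delta * exp (- (delta * PI / 2)) in
  exists p0 : R,
    p1 - p0 = alpha / 4 * q
    /\ p1 - pw = alpha / (2 * PI) * q * ln (Delta / Rw)
                 + beta * (q ^ 2 / (4 * PI ^ 2)) * (1 / Rw - 1 / Delta)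
    /\ p0 - pw = alpha / (2 * PI) * q * ln (R0 / Rw)
                 + beta * (q ^ 2 / (4 * PI ^ 2)) * (1 / Rw - 1 / R0).
Proof.
  intros R0.
  assert (PI_gt0 := PI_RGT_0).
  assert (Delta_gt0 : 0 < Delta) by lra.
  assert (ln_R0 : ln (R0 / Rw) = ln (Delta / Rw) - delta * PI / 2).
  (* Splitting off the exponential factor lets [ln] return its exponent exactly. *)
  { replace (R0 / Rw) with (Delta / Rw * exp (- (delta * PI / 2)))
      by (unfold R0; field; lra).
    rewrite ln_mult, ln_exp.
    - ring.
    - now apply Rdiv_lt_0_compat.
    - apply exp_pos. }
  assert (inv_R0 : 1 / R0 = exp (delta * PI / 2) / Delta).
  (* [exp_Ropp] moves the exponential into a denominator; its positivity gives [field] the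
     nonvanishing. *)
  { assert (E_gt0 := exp_pos (delta * PI / 2)).
    unfold R0. rewrite exp_Ropp. field. lra. }
  exists (p1 - alpha / 4 * q).
  split; [ring | split; [exact pressure_drop |]].
  rewrite ln_R0, inv_R0.
  (* Multiplying, rather than dividing the goal by [q], also covers [q = 0]. *)
  apply (f_equal (Rmult (alpha / 4 * q))) in delta_eq.
  rewrite Rmult_1_r in delta_eq.
  replace (p1 - alpha / 4 * q - pw) with (p1 - pw - alpha / 4 * q) by ring.
  (* Expanding [alpha / 4 * q] backwards leaves a rational identity with the logarithm and
     exponential as atoms. *)
  rewrite pressure_drop, <- delta_eq.
  field. lra.
Qed.
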